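(* Let $M(n)$ denote the Motzkin numbers. For each prime $p\in\{5,13,31,37,61,79,97,103\}$ and every integer $n\ge0$, $M(n)\not\equiv0\pmod{p^2}$. For every other prime $p<200$, there exists an integer $n\ge0$ such that $p^2$ divides $M(n)$.
   Context: The Motzkin numbers are $M(n)=\operatorname{ct}[(x^{-1}+1+x)^n(1-x^2)]$, where $\operatorname{ct}$ denotes the constant term of a Laurent polynomial in $x$; equivalently $M(n)=\sum_{k\ge0}\binom{n}{2k}\frac{1}{k+1}\binom{2k}{k}$, so $M(0),M(1),\dots=1,1,2,4,9,21,51,\dots$. *)

(* Defs.v *)
From mathcomp Require Import all_boot all_order all_algebra.
From mathcomp Require Import zify ring.

Set Implicit Arguments.
Unset Strict Implicit.
Unset Printing Implicit Defensive.

Import GRing.Theory.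
Local Open Scope ring_scope.

(* A Laurent polynomial in x over int is written as x^(-k) * q with
   q : {poly int}; its constant term is then the coefficient of x^k in q. *)
Definition laurent_ct (k : nat) (q : {poly int}) : int := q`_k.

(* (x^-1 + 1 + x)^n * (1 - x^2) = x^(-n) * ((1 + x + x^2)^n * (1 - x^2)). *)
Definition motzkin (n : nat) : int :=
  laurent_ct n ((1 + 'X + 'X^2) ^+ n * (1 - 'X^2)).

Lemma coef_1pX2 (m j : nat) :
  ((1 + 'X^2) ^+ m : {poly int})`_j = (if odd j then 0 else 'C(m, j./2)%:R).
Proof.
elim: m j => [|m IH] j.
  rewrite expr0 coef1; case: j => [|[|j]] //=; rewrite ?bin0n //; by case: ifP.
rewrite exprSr mulrDr mulr1 coefD coefMXn !IH.
case: j => [|[|j]] //=; first by rewrite !bin0 addr0.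
by rewrite subn2 /= negbK; case: ifP => _; rewrite ?addr0 // binS natrD.
Qed.

Lemma motzkin_sum (n : nat) : motzkin n =
  (\sum_(k < n.+1) 'C(n, k.*2) * ('C(k.*2, k) %/ k.+1))%N%:Z.
Proof.
have catal k : ('C(k.*2, k) %/ k.+1)%N%:Z =
    'C(k.*2, k)%:Z - (if k is k'.+1 then 'C(k.*2, k')%:Z else 0).
  case: k => [|k]; first by rewrite bin0.
  have h : (k.+2 * 'C(k.+1.*2, k) = k.+1 * 'C(k.+1.*2, k.+1))%N.
    have := mul_bin_left k.+1.*2 k; lia.
  have -> : 'C(k.+1.*2, k.+1) =
      (('C(k.+1.*2, k.+1) - 'C(k.+1.*2, k)) * k.+2)%N by nia.
  rewrite mulnK // -?mulnE; nia.
rewrite /motzkin /laurent_ct.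
have -> : 1 + 'X + 'X^2 = 'X + (1 + 'X^2) :> {poly int} by ring.
rewrite exprDn mulr_suml coef_sum.
have E i : (('X^(n - i) * (1 + 'X^2) ^+ i *+ 'C(n, i) * (1 - 'X^2))
             : {poly int})`_n =
  if (i <= n)%N
  then (if odd i then 0 else ('C(n, i) * ('C(i, i./2) %/ i./2.+1))%N%:Z)
  else 0.
  case: leqP => hi; last by rewrite bin_small // mulr0n mul0r coef0.
  rewrite mulrnAl coefMn -mulrA coefXnM ltnNge leq_subr /= subKn //.
  rewrite mulrBr mulr1 coefB coefMXn !coef_1pX2.
  case: ifP => oi.
    case: (ltnP i 2) => h2; first by rewrite subr0 mul0rn.
    by rewrite oddB // oi subr0 mul0rn.
  have ei : i = i./2.*2 by have := odd_double_half i; rewrite oi.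
  move: (i./2) ei oi hi => k ->{i} oi hi; rewrite PoszM catal.
  case: k oi hi => [|k] oi hi /=; first by rewrite !bin0 -[LHS]mulr_natl !natz.
  by rewrite ?doubleS ?subn2 /= ?odd_double ?doubleK -[LHS]mulr_natl !natz.
rewrite [LHS](eq_bigr _ (fun (i : 'I_n.+1) _ => E i)).
rewrite (big_morph Posz PoszD (erefl _)).
pose F i : int := ('C(n, i) * ('C(i, i./2) %/ i./2.+1))%N%:Z.
have -> : \sum_(i < n.+1)
    (if (i <= n)%N then (if odd i then 0 else F i) else 0) =
  \sum_(0 <= i < n.+1 + n.+1 | ~~ odd i) F i.
  rewrite (@big_cat_nat _ _ _ n.+1) ?leq_addr //=.
  rewrite [X in _ + X]big_nat_cond [X in _ + X]big1; last first.
    by move=> i /andP[/andP[hi _] _]; rewrite /F bin_small.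
  rewrite addr0 big_mkord [RHS]big_mkcond /=.
  by apply: eq_bigr => i _; rewrite -ltnS ltn_ord; case: odd.
have D m : \sum_(0 <= i < m + m | ~~ odd i) F i = \sum_(k < m) F k.*2.
  elim: m => [|m IH]; first by rewrite big_ord0 big_geq.
  rewrite big_ord_recr /= -IH addSn addnS !big_mkcond /= !big_nat_recr //=.
  by rewrite addnn odd_double /= addr0 [in RHS]big_mkcond.
by rewrite D; apply: eq_bigr => k _; rewrite /F doubleK.
Qed.

(* Main.v *)
(* Write [T n] for the central trinomial coefficient, so that
   [2 (n + 2) M(n) = 3 T(n) + T(n + 1)].  Since [(1 + x + x^2)^p] is
   [1 + x^p + x^2p] plus a multiple of [p], one gets [T(p m) = T(m)] modulo [p^2]
   as soon as [T(p) = 1], and the recurrence of [T] then propagates this to the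
   first-order expansion
     [T(p m + d) = T(d) T(m) + p (b_d m T(m) + c_d m T(m - 1))]   ([d < p]),
   in which [T(m)] and [m T(m - 1)] are only needed modulo [p] in the last term, where
   Lucas' congruence determines them from the next digit [e] of [m].  If [p] divides no
   [T(d)], whether [p^2] divides [M(n)] hence depends on the last two digits of [n],
   except when the last digit is [p - 1] or [p - 2].  There, with [s = T(p - 1)]
   modulo [p] and [w = T(p - 1) - s], one has
   [T(p m + p - 1) = (s + (m + 1) w) T(m)], and [M(n)] becomes a unit times
     [K_a(m) = a (s + (m + 1) w) T(m) + T(m + 1)]   ([a = 3] or [a = -1]).
   As [K_a(p m + p - 1) = K_(a s)(m)], trailing digits [p - 1] can be dropped, after which
   [K_a] again depends on two digits only: a finite computation for each prime decides.
   The witnesses for the remaining primes other than 2, 3 and 19 come from zeros of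
   [K_3] or [K_(3 s)]. *)

From Stdlib Require Import ZArith.
Require Import Defs.
From mathcomp Require Import all_boot all_order all_algebra.
From mathcomp Require Import zify ring ssrZ.

Set Implicit Arguments.
Unset Strict Implicit.
Unset Printing Implicit Defensive.

Import Order.TTheory GRing.Theory Num.Theory.
Local Open Scope ring_scope.

(** * Coefficients of powers of [1 + x + x^2] near the centre, and Motzkin numbers *)

Section Trinomial.

Definition trinomial : {poly int} := 1 + 'X + 'X^2.

Definition central (n : nat) : int := (trinomial ^+ n)`_n.

(** The derivative of the power is [n + 1] times [(1 + 2x) (1 + x + x^2)^n]. *)
Lemma trinomial_derivE n k :
  (trinomial ^+ n.+1)`_k.+1 *+ k.+1 =
  ((trinomial ^+ n)`_k + (if k is k'.+1 then (trinomial ^+ n)`_k' else 0) *+ 2)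
    *+ n.+1.
Proof.
have -> : (trinomial ^+ n.+1)`_k.+1 *+ k.+1 = ((trinomial ^+ n.+1)^`())`_k.
  by rewrite coef_deriv.
rewrite deriv_exp coefMn /=; congr (_ *+ _).
rewrite /trinomial !derivD derivX derivXn -polyC1 derivC add0r expr1.
rewrite mulrDl mul1r mulrnAl coefD coefMn coefXM.
by case: k.
Qed.

Lemma trinomial_exprS n k :
  (trinomial ^+ n.+1)`_k =
  (trinomial ^+ n)`_k + (if k is k'.+1 then (trinomial ^+ n)`_k' else 0) +
  (if k is k'.+2 then (trinomial ^+ n)`_k' else 0).
Proof.
rewrite exprS /trinomial !mulrDl mul1r !coefD coefXM coefXnM.
by case: k => [|[|k]] //=; rewrite subn2.
Qed.

(* The coefficients at distance 1 and 2 below the central one. *)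
Let near n := if n is k.+1 then (trinomial ^+ n)`_k else 0.
Let far n := if n is k.+2 then (trinomial ^+ n)`_k else 0.

Let trinomial_sym n : (trinomial ^+ n)`_n.+1 = near n.
Proof.
case: n => [|n] /=; first by rewrite expr0 coef1.
(* The derivative and the product rule give two formulas for the central coefficient of the next
   power; subtracting them equates the two neighbours of the centre. *)
have /(pmulrnI (isT : 0 < n.+2)%N) := trinomial_derivE n.+1 n.+1.
by rewrite trinomial_exprS /=; lia.
Qed.

Let centralS n : central n.+1 = central n + 2 * near n.
Proof.
by rewrite /central trinomial_exprS trinomial_sym /near; case: n => [|n]; ring.
Qed.

Let nearS n : near n.+1 = central n + near n + far n.
Proof. by rewrite /near /far trinomial_exprS /central; case: n => [|[]]. Qed.

Let near_rec n : n%:R * near n.+1 = n.+1%:R * (near n + 2 * far n).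
Proof.
case: n => [|n]; first by rewrite /near /far; ring.
have := trinomial_derivE n.+1 n; rewrite /near /far mulr_natl => ->.
by case: n => [|n]; ring.
Qed.

Let motzkinE n : motzkin n = central n - far n.
Proof.
rewrite /motzkin /laurent_ct mulrBr mulr1 coefB coefMXn /far.
by case: n => [|[|n]] //=; rewrite subn2.
Qed.

Lemma motzkin_central n : 2 * motzkin n = 3 * central n + 2 * central n.+1 - central n.+2.
Proof. by rewrite motzkinE !centralS nearS; ring. Qed.

Lemma motzkin_central' n :
  2 * (n.+2%:R * motzkin n) = 3 * central n + central n.+1.
Proof.
have := near_rec n; rewrite motzkinE !centralS nearS; lia.
Qed.

Lemma centralSS n :
  n.+2%:R * central n.+2 = (2 * n + 3)%:R * central n.+1 + (3 * n.+1)%:R * central n.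
Proof.
have := motzkin_central n; have := motzkin_central' n; lia.
Qed.

End Trinomial.

(** * The [p]-th power of [1 + x + x^2] modulo [p] *)

Lemma exprD_prime (R : comNzRingType) (p : nat) (x y : R) : prime p ->
  exists z, (x + y) ^+ p = x ^+ p + y ^+ p + p%:R * z.
Proof.
move=> p_prime; have p_gt0 := prime_gt0 p_prime.
exists (\sum_(1 <= i < p) x ^+ (p - i) * y ^+ i *+ ('C(p, i) %/ p)).
rewrite exprDn -(big_mkord xpredT (fun i => x ^+ (p - i) * y ^+ i *+ 'C(p, i))).
rewrite big_nat_recr //= big_ltn // bin0 binn subn0 subnn !expr0 !mulr1 mul1r !mulr1n.
rewrite -addrA [X in _ + X]addrC -addrA mulr_sumr; congr (_ + (_ + _)).
rewrite !big_nat; apply: eq_bigr => i lti.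
by rewrite mulr_natl -mulrnA divnK // prime_dvd_bin.
Qed.

Lemma exprD_sqr (R : comNzRingType) (x y : R) n :
  exists z, (x + y) ^+ n.+1 = x ^+ n.+1 + n.+1%:R * x ^+ n * y + y ^+ 2 * z.
Proof.
elim: n => [|n [z IH]]; first by exists 0; rewrite !expr1 expr0; ring.
by exists ((x + y) * z + n.+1%:R * x ^+ n); rewrite exprS IH !(exprS x); ring.
Qed.

Lemma trinomial_exp_prime p : prime p ->
  exists E, trinomial ^+ p = trinomial \Po 'X^p + p%:R * E.
Proof.
move=> p_prime.
have [z1 e1] := exprD_prime (1 + 'X : {poly int}) 'X^2 p_prime.
have [z2 e2] := exprD_prime (1 : {poly int}) 'X p_prime.
exists (z1 + z2); rewrite /trinomial e1 e2 expr1n !rmorphD rmorph1 rmorphXn /=.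
by rewrite comp_polyX -!exprM mulnC; ring.
Qed.

Lemma coef_trinomial k : trinomial`_k = (k < 3)%N%:R.
Proof. by rewrite /trinomial !coefD coef1 coefX coefXn; case: k => [|[|[]]]. Qed.

Lemma size_trinomial : size trinomial = 3%N.
Proof.
apply/eqP; rewrite eqn_leq; apply/andP; split.
  by apply/leq_sizeP => k; rewrite coef_trinomial leqNgt; case: leqP.
by rewrite ltnNge; apply/negP => /leq_sizeP/(_ 2%N isT); rewrite coef_trinomial.
Qed.

(** The exponents [0] and [2 p] are the two ends, with coefficient 1, and beyond them both sides
    vanish. Among multiples of [p], only the central exponent can show a discrepancy. *)
Lemma trinomial_exp_multiple p j : (0 < p)%N -> j != 1%N ->
  (trinomial ^+ p)`_(p * j) = (trinomial \Po 'X^p)`_(p * j).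
Proof.
move=> p_gt0 neq1; rewrite coef_comp_poly_Xn // dvdn_mulr // mulKn //.
have sz : size (trinomial ^+ p) = (p * 2).+1.
  rewrite -[LHS](@prednK) ?size_exp ?size_trinomial 1?mulnC //.
  by rewrite size_poly_gt0 expf_neq0 // -size_poly_gt0 size_trinomial.
have [j2|j2|->] := ltngtP j 2.
- case: j neq1 j2 => [|[]] // _ _; rewrite muln0 -!horner_coef0 horner_exp.
  by rewrite !horner_coef0 coef_trinomial expr1n.
- by rewrite !nth_default ?size_trinomial // sz ltn_pmul2l.
- have := lead_coef_exp trinomial p; rewrite !lead_coefE sz size_trinomial /=.
  by rewrite coef_trinomial expr1n => ->.
Qed.

(** * Central trinomial coefficients modulo the square of a prime *)

Section ModuloPrimeSquare.

Variables (R : comUnitRingType) (p : nat).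
Hypotheses (p_prime : prime p) (p2_eq0 : p%:R ^+ 2 = 0 :> R).

Definition centralr n : R := (central n)%:~R.
Local Notation t := centralr.

(** Expand [(Q + p E)^m] with [Q = 1 + x^p + x^(2p)]. In the first-order term, [Q^(m-1)] has only
    exponents divisible by [p], so only the coefficients of [E] at multiples of [p] reach exponent
    [p m], and [p] kills those. *)
Lemma centralr_prime_mul m : t p = 1 -> t (p * m) = t m.
Proof.
move=> tp1; have p_gt0 := prime_gt0 p_prime.
case: m => [|m]; first by rewrite muln0.
have [E defPp] := trinomial_exp_prime p_prime.
(* Both polynomials agree at exponent [p j] for [j != 1]; for [j = 1] they differ by [T(p) - 1],
   which is zero by assumption. *)
have E0 j : p%:R * (E`_(p * j))%:~R = 0 :> R.
  have : p%:R * E`_(p * j) = (trinomial ^+ p)`_(p * j) - (trinomial \Po 'X^p)`_(p * j).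
    by rewrite defPp coefD [p%:R * E]mulr_natl coefMn addrAC subrr add0r mulr_natl.
  move/(congr1 (fun x => x%:~R : R)); rewrite rmorphM /= rmorph_nat => ->.
  have [->|/eqP neq1] := eqVneq j 1; last first.
    by rewrite trinomial_exp_multiple ?subrr //; apply/eqP.
  rewrite muln1 rmorphB /= -[(_`_p)%:~R]/(t p) tp1 coef_comp_poly_Xn // dvdnn divnn p_gt0.
  by rewrite /trinomial !coefD coef1 coefX coefXn subrr.
have comp_exp k n : ((trinomial \Po 'X^p) ^+ n)`_k =
    (if (p %| k)%N then (trinomial ^+ n)`_(k %/ p)%N else 0).
  by rewrite -rmorphXn /= coef_comp_poly_Xn.
rewrite /centralr /central exprM defPp; move: (trinomial \Po 'X^p) comp_exp => Q comp_exp.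
have [z ->] := exprD_sqr Q (p%:R * E) m.
rewrite exprMn -natrX -!mulrA !mulr_natl !coefD !coefMn.
rewrite comp_exp dvdn_mulr // mulKn // !rmorphD !rmorphMn /=.
rewrite -[_ *+ (p ^ 2)]mulr_natl natrX p2_eq0 mul0r addr0.
suff -> : ((Q ^+ m * (E *+ p))`_(p * m.+1))%:~R = 0 :> R.
  by rewrite mul0rn addr0.
rewrite coefM rmorph_sum big1 //= => i _; rewrite comp_exp.
case: ifP => [/dvdnP[k ->]|_]; last by rewrite mul0r.
rewrite [(k * p)%N]mulnC -mulnBr rmorphM /= coefMn rmorphMn /=.
by rewrite -[_ *+ p]mulr_natl E0 mulr0.
Qed.

Let p_gt0 : (0 < p)%N := prime_gt0 p_prime.

Lemma unit_mod_prime (u z : R) : u \is a GRing.unit -> u + p%:R * z \is a GRing.unit.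
Proof.
move=> u_unit; suff : (u + p%:R * z) * (u - p%:R * z) \is a GRing.unit.
  by rewrite unitrM => /andP[].
suff -> : (u + p%:R * z) * (u - p%:R * z) = u ^+ 2 by rewrite unitrX.
have -> : (u + p%:R * z) * (u - p%:R * z) = u ^+ 2 - p%:R ^+ 2 * z ^+ 2 by ring.
by rewrite p2_eq0 mul0r subr0.
Qed.

Lemma unit_ndvd_prime (x : int) : ~~ (p %| x)%Z -> (x%:~R : R) \is a GRing.unit.
Proof.
move=> ndvd; have /coprimezP[[u v] /= uv] : coprimez p x.
  by rewrite coprimezE prime_coprime // -dvdzE.
have : (u * p + v * x)%:~R = 1 :> R by rewrite uv.
rewrite rmorphD !rmorphM /= -pmulrn => uvR.
suff : (v%:~R * x%:~R : R) \is a GRing.unit by rewrite unitrM => /andP[].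
have -> : v%:~R * x%:~R = 1 + p%:R * - u%:~R :> R.
  by rewrite mulrN; apply: (canRL (addrK _)); rewrite addrC [p%:R * _]mulrC.
by apply: unit_mod_prime; rewrite unitr1.
Qed.

Lemma unit_mod_prime_nat m d : (0 < d < p)%N -> ((p * m + d)%:R : R) \is a GRing.unit.
Proof.
move=> /andP[d_gt0 ltdp]; rewrite natrD natrM addrC unit_mod_prime // pmulrn.
by rewrite unit_ndvd_prime // dvdzE /= gtnNdvd.
Qed.

Lemma centralrSS n :
  n.+2%:R * t n.+2 = (2 * n + 3)%:R * t n.+1 + (3 * n.+1)%:R * t n.
Proof.
have /(congr1 (fun x => x%:~R : R)) := centralSS n.
by rewrite rmorphD !rmorphM /= !rmorph_nat.
Qed.

Lemma centralr0 : t 0 = 1. Proof. by rewrite /t /central expr0 coef1. Qed.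
Lemma centralr1 : t 1 = 1.
Proof. by rewrite /t /central expr1 coef_trinomial. Qed.

(* [b d] and [c d] are the two first-order coefficients, modulo [p], of the
   central trinomial coefficient at [p m + d] (see [centralr_prime_mulD]). *)
Record digit_coefs (s : R) (b c : nat -> R) : Prop := DigitCoefs {
  centralr_prime : t p = 1;
  sign_sqr : s ^+ 2 = 1;
  centralr_pred : p%:R * t p.-1 = p%:R * s;
  b_0 : b 0 = 0;
  b_1 : b 1 = 1;
  c_0 : c 0 = 0;
  c_1 : c 1 = 3 * s;
  b_rec : forall d, (d.+2 < p)%N ->
    p%:R * (d.+2%:R * b d.+2) = p%:R * ((2 * d + 3)%:R * b d.+1
      + (3 * d.+1)%:R * b d + 2 * t d.+1 + 3 * t d - t d.+2);
  c_rec : forall d, (d.+2 < p)%N ->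
    p%:R * (d.+2%:R * c d.+2) =
    p%:R * ((2 * d + 3)%:R * c d.+1 + (3 * d.+1)%:R * c d);
  b_pred : p%:R * b p.-1 = t p.-1 - s;
  c_pred : p%:R * c p.-1 = 0
}.

(** * First-order expansion along the last base-[p] digit *)

Section DigitExpansion.

Variables (s : R) (b c : nat -> R).
Hypothesis coefs : digit_coefs s b c.

Let tp1 := centralr_prime coefs.

(** Lucas' congruence, the factor [p] encoding congruence modulo [p]. Both sides obey the recurrence
    of [T] modulo [p], whose leading coefficient is a unit. *)
Lemma mul_centralr_prime_mulD m d : (d < p)%N ->
  p%:R * t (p * m + d) = p%:R * (t m * t d).
Proof.
have p1 k (x : R) : p%:R * ((p%:R * k + 1) * x) = p%:R * x.
  by rewrite mulrDl mul1r mulrDr !mulrA -expr2 p2_eq0 !mul0r add0r.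
suff : ((d < p)%N -> p%:R * t (p * m + d) = p%:R * (t m * t d)) /\
  ((d.+1 < p)%N -> p%:R * t (p * m + d.+1) = p%:R * (t m * t d.+1)) by case.
elim: d => [|d [IH0 IH1]]; split=> // ltdp.
- by rewrite addn0 centralr0 mulr1 centralr_prime_mul.
(* For [d = 1] and positive [m], the recurrence multiplies [T(p m - 1)] by [3 p m], a term killed by
   the outer factor [p]. *)
- case: m => [|m]; first by rewrite muln0 add0n centralr0 mul1r.
  have := centralrSS (p * m + p.-1); rewrite -!addnS prednK //.
  rewrite addnS [(p * m + p)%N]addnC -mulnS.
  rewrite (centralr_prime_mul _ tp1) centralr1 mulr1.
  move/(congr1 (fun x => p%:R * x)); rewrite addn1.
  rewrite (_ : (p * m.+1).+1%:R = p%:R * m.+1%:R + 1); last by rewrite -addn1 natrD natrM.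
  rewrite p1 => ->; rewrite mulrDr.
  rewrite (_ : (2 * _ + 3 = p * (2 * m.+1) + 1)%N); last by nia.
  rewrite (_ : (3 * _ = p * (3 * m.+1))%N); last by nia.
  rewrite natrD !(natrM _ p) -[p%:R * _ * t _]mulrA.
  by rewrite p1 !mulrA -expr2 p2_eq0 !mul0r addr0.
- have u : ((p * m + d.+2)%:R : R) \is a GRing.unit by apply: unit_mod_prime_nat.
  have ltd := ltnW ltdp; have := IH1 ltd; have := IH0 (ltnW ltd).
  have rec_d := centralrSS d; have rec := centralrSS (p * m + d).
  rewrite !(addnS (p * m)) in u rec *.
  move: (t (p * m + d).+2) (t (p * m + d).+1) (t (p * m + d)) rec.
  move: (t d.+2) (t d.+1) (t d) (t m) rec_d => x2 x1 x0 x rec_d z2 z1 z0 rec e0 e1.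
  apply: (mulrI u); rewrite mulrCA rec.
  rewrite [LHS](_ : _ = (2 * d + 3)%:R * (p%:R * z1) + (3 * d.+1)%:R * (p%:R * z0)
    + p%:R ^+ 2 * (m%:R * (2 * z1 + 3 * z0))); last by ring.
  rewrite [RHS](_ : _ = p%:R * x * (d.+2%:R * x2) + p%:R ^+ 2 * (m%:R * x * x2)); last by ring.
  by rewrite p2_eq0 e0 e1 rec_d; ring.
Qed.

Lemma mul_centralr_pred m :
  (p * m)%:R * t (p * m).-1 = p%:R * (t p.-1 * (m%:R * t m.-1)).
Proof.
case: m => [|m]; first by rewrite muln0 !mul0r !mulr0.
rewrite (_ : (p * m.+1).-1 = p * m + p.-1)%N; last by lia.
rewrite mulnC natrM -mulrA mul_centralr_prime_mulD ?prednK //=; ring.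
Qed.

(** The analogue of Lucas' congruence for [n T(n - 1)], the other quantity in the first-order term.
    The factor [d] masks the truncated predecessor at [d = 0]. *)
Lemma mul_centralr_prime_mulD_pred m d : (d < p)%N ->
  p%:R * ((p * m + d)%:R * t (p * m + d).-1) = p%:R * (d%:R * (t m * t d.-1)).
Proof.
move=> ltdp; rewrite natrD natrM mulrDl mulrDr !mulrA -expr2 p2_eq0 !mul0r add0r.
case: d ltdp => [|d] ltdp; first by rewrite !(mulr0, mul0r).
rewrite addnS /= mulrAC mul_centralr_prime_mulD 1?ltnW //; ring.
Qed.

(** Induction by the recurrence, with unit leading coefficient [p m + d + 2]. Sorting its terms by
    [T(m)], [p m T(m)] and [p m T(m - 1)] leaves the recurrences of [T], [b] and [c]. *)
Lemma centralr_prime_mulD m d : (d < p)%N ->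
  t (p * m + d) = t d * t m + p%:R * (b d * (m%:R * t m) + c d * (m%:R * t m.-1)).
Proof.
pose F d := t d * t m + p%:R * (b d * (m%:R * t m) + c d * (m%:R * t m.-1)).
suff : ((d < p)%N -> t (p * m + d) = F d) /\
  ((d.+1 < p)%N -> t (p * m + d.+1) = F d.+1) by case.
elim: d => [|d [IH0 IH1]]; split=> // ltdp.
- rewrite addn0 centralr_prime_mul // /F (b_0 coefs) (c_0 coefs) centralr0; ring.
- have u : ((p * m + 1)%:R : R) \is a GRing.unit by apply: unit_mod_prime_nat.
  apply: (mulrI u).
  (* The last term equals [3 p s m T(m - 1)]: this is the origin of [c_1 = 3 s]. *)
  have -> : (p * m + 1)%:R * t (p * m + 1) = (2 * (p * m) + 1)%:R * t (p * m)
       + 3 * ((p * m)%:R * t (p * m).-1).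
    case: (p * m)%N => [|n]; first by rewrite centralr0 centralr1; ring.
    by rewrite addn1 centralrSS /=; ring.
  rewrite mul_centralr_pred (mulrA _ (t p.-1)) (centralr_pred coefs) centralr_prime_mul //.
  rewrite /F centralr1 (b_1 coefs) (c_1 coefs).
  rewrite [RHS](_ : _ = (2 * (p * m) + 1)%:R * t m + 3 * (p%:R * s * (m%:R * t m.-1))
    + p%:R ^+ 2 * (m%:R * (m%:R * t m + 3 * s * (m%:R * t m.-1)))); last by ring.
  by rewrite p2_eq0 mul0r addr0.
- have u : ((p * m + d.+2)%:R : R) \is a GRing.unit by apply: unit_mod_prime_nat.
  have rec_d := centralrSS d; have rec := centralrSS (p * m + d).
  have ltd := ltnW ltdp; apply: (mulrI u).
  have := IH1 ltd; have := IH0 (ltnW ltd); have := b_rec coefs ltdp; have := c_rec coefs ltdp.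
  rewrite /F !(addnS (p * m)) in u rec *.
  move: (t (p * m + d).+2) (t (p * m + d).+1) (t (p * m + d)) rec.
  move: (t d.+2) (t d.+1) (t d) (t m) (t m.-1) rec_d => x2 x1 x0 x y rec_d z2 z1 z0 rec.
  move: (b d.+2) (b d.+1) (b d) (c d.+2) (c d.+1) (c d) => b2 b1' b0' c2 c1' c0' ec eb e0 e1.
  rewrite rec e0 e1.
  rewrite [LHS](_ : _ = x * ((2 * d + 3)%:R * x1 + (3 * d.+1)%:R * x0)
    + m%:R * x * (p%:R * ((2 * d + 3)%:R * b1' + (3 * d.+1)%:R * b0' + 2 * x1 + 3 * x0 - x2))
    + m%:R * y * (p%:R * ((2 * d + 3)%:R * c1' + (3 * d.+1)%:R * c0'))
    + p%:R * m%:R * x * x2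
    + p%:R ^+ 2 * (m%:R * (2 * (b1' * (m%:R * x) + c1' * (m%:R * y))
        + 3 * (b0' * (m%:R * x) + c0' * (m%:R * y))))); last by ring.
  rewrite -rec_d -eb -ec p2_eq0.
  rewrite [RHS](_ : _ = x * (d.+2%:R * x2) + m%:R * x * (p%:R * (d.+2%:R * b2))
    + m%:R * y * (p%:R * (d.+2%:R * c2)) + p%:R * m%:R * x * x2
    + p%:R ^+ 2 * (m%:R * (b2 * (m%:R * x) + c2 * (m%:R * y)))); last by ring.
  by rewrite p2_eq0; ring.
Qed.

(** * The last digits [p - 1] and [p - 2], and the forms [K_a] *)

Hypothesis p_gt2 : (2 < p)%N.
Let w := t p.-1 - s.

Let pw : p%:R * w = 0.
Proof. by rewrite mulrBr (centralr_pred coefs) subrr. Qed.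

Lemma centralr_prime_mul_pred m :
  t (p * m + p.-1) = (s + m.+1%:R * w) * t m.
Proof.
rewrite centralr_prime_mulD ?prednK // mulrDr !mulrA (b_pred coefs) (c_pred coefs) /w; ring.
Qed.

Definition motzkinr n : R := (motzkin n)%:~R.

Lemma motzkinr_central n :
  2 * (n.+2%:R * motzkinr n) = 3 * t n + t n.+1.
Proof.
have /(congr1 (fun x => x%:~R : R)) := motzkin_central' n.
by rewrite rmorphD !rmorphM /= !rmorph_nat.
Qed.

Lemma motzkinr_central2 n :
  2 * motzkinr n = 3 * t n + 2 * t n.+1 - t n.+2.
Proof.
have /(congr1 (fun x => x%:~R : R)) := motzkin_central n.
by rewrite rmorphB rmorphD !rmorphM /= !rmorph_nat.
Qed.

(* Governs the divisibility of the Motzkin numbers at p m + p - 1 (a = 3) and at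
   p m + p - 2 (a = -1). *)
Definition motzkin_form (a : R) m := a * (s + m.+1%:R * w) * t m + t m.+1.
Local Notation K := motzkin_form.

Lemma motzkinr_pred m :
  2 * ((p * m + p.+1)%:R * motzkinr (p * m + p.-1)) = K 3 m.
Proof.
have := motzkinr_central (p * m + p.-1).
rewrite -!addnS prednK // => ->; rewrite centralr_prime_mul_pred /K.
by rewrite addnC -mulnS (centralr_prime_mul _ tp1) mulrA.
Qed.

(** Here [n + 2 = p (m + 1)] is not invertible, so [motzkinr_central2] is used and [T(p m + p - 2)]
    eliminated by the recurrence. Its coefficient there is [3 (p (m + 1) - 1)], and [1 - p (m + 1)]
    has inverse [1 + p (m + 1)]. *)
Lemma motzkinr_pred2 m :
  2 * motzkinr (p * m + p.-2) = - (1 + (p * m.+1)%:R) * K (-1) m.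
Proof.
rewrite motzkinr_central2; have := centralrSS (p * m + p.-2).
have e1 : (p * m + p.-2).+1 = (p * m + p.-1)%N by lia.
have e2 : (p * m + p.-1).+1 = (p * m.+1)%N by lia.
have -> : ((2 * (p * m + p.-2) + 3)%:R = 2 * (p * m.+1)%:R - 1 :> R).
  by apply: (canRL (addrK _)); rewrite -[1]/(1%:R) -natrD -natrM; congr _%:R; lia.
have -> : ((3 * (p * m + p.-2).+1)%:R = 3 * (p * m.+1)%:R - 3 :> R).
  by apply: (canRL (addrK _)); rewrite -natrD -natrM; congr _%:R; lia.
rewrite e1 e2 (centralr_prime_mul _ tp1) /K -mulrA -centralr_prime_mul_pred natrM.
move: (t (p * m + p.-2)) (t (p * m + p.-1)) (t m.+1) => v u z rec.
rewrite [LHS](_ : _ = - (1 + p%:R * m.+1%:R) * (3 * (p%:R * m.+1%:R) - 3) * v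
  + p%:R ^+ 2 * (3 * m.+1%:R ^+ 2 * v) + 2 * u - z); last by ring.
rewrite -mulrA -[X in _ * X](addKr ((2 * (p%:R * m.+1%:R) - 1) * u)) -rec p2_eq0.
rewrite [LHS](_ : _ = - (1 + p%:R * m.+1%:R) * (-1 * u + z)
  + p%:R ^+ 2 * (2 * m.+1%:R ^+ 2 * u - m.+1%:R ^+ 2 * z)); last by ring.
by rewrite p2_eq0 mul0r addr0.
Qed.

(** The successor of the index is [p (m + 1)], so its product with [w] vanishes and [a s] is left as
    multiplier. *)
Lemma motzkin_form_pred a m : K a (p * m + p.-1) = K (a * s) m.
Proof.
have e : (p * m + p.-1).+1 = (p * m.+1)%N by lia.
rewrite /K e (centralr_prime_mul _ tp1) natrM -[p%:R * _ * w]mulrA [_%:R * w]mulrC.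
rewrite [p%:R * _]mulrA pw mul0r addr0 centralr_prime_mul_pred; ring.
Qed.

Lemma motzkin_form_digit a m d : (d.+1 < p)%N ->
  K a (p * m + d) = K a d * t m
    + p%:R * ((a * s * b d + b d.+1) * (m%:R * t m)
              + (a * s * c d + c d.+1) * (m%:R * t m.-1)).
Proof.
move=> ltdp; rewrite /K -addnS !centralr_prime_mulD // 1?ltnW // addnS.
rewrite (_ : (p * m + d).+1%:R * w = d.+1%:R * w); last first.
  by rewrite -addnS natrD natrM mulrDl -mulrA mulrCA pw mulr0 add0r.
move: (t m) (t m.-1) => x y.
rewrite [LHS](_ : _ = (a * (s + d.+1%:R * w) * t d + t d.+1) * x
    + p%:R * ((a * s * b d + b d.+1) * (m%:R * x)
              + (a * s * c d + c d.+1) * (m%:R * y))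
    + p%:R * w * (d.+1%:R * a * (b d * (m%:R * x) + c d * (m%:R * y)))); last by ring.
by rewrite pw mul0r addr0.
Qed.

(** Once [p] divides [K_a(d)], both [T(p m + e)] and [(p m + e) T(p m + e - 1)] matter only modulo
    [p], and Lucas' congruence lets [T(m)] factor out. *)
Lemma motzkin_form_digits a m d e f : (d.+1 < p)%N -> (e < p)%N ->
  K a d = p%:R * f -> K a (p * (p * m + e) + d) = K a (p * e + d) * t m.
Proof.
move=> ltdp ltep Kad; rewrite !motzkin_form_digit // Kad.
have e1 := mul_centralr_prime_mulD m ltep.
have e2 := mul_centralr_prime_mulD_pred m ltep.
set x := t (p * m + e) in e1 *; set y := (_ * t (_).-1) in e2 *.
rewrite [LHS](_ : _ = f * (p%:R * x)
    + ((a * s * b d + b d.+1) * (p * m + e)%:R) * (p%:R * x)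
    + (a * s * c d + c d.+1) * (p%:R * y)); last by ring.
rewrite e1 e2 natrD natrM.
rewrite [LHS](_ : _ = (p%:R * f * t e + p%:R * ((a * s * b d + b d.+1) * (e%:R * t e)
    + (a * s * c d + c d.+1) * (e%:R * t e.-1))) * t m
   + p%:R ^+ 2 * ((a * s * b d + b d.+1) * (m%:R * (t m * t e)))); last by ring.
by rewrite p2_eq0 mul0r addr0.
Qed.

(** * Nonvanishing when [p] divides no [T(d)] with [d < p] *)

Section NonVanishing.

Hypothesis centralr_unit : forall d, (d < p)%N -> t d \is a GRing.unit.

Lemma centralr_all_unit n : t n \is a GRing.unit.
Proof.
elim/ltn_ind: n => n IH; case: (ltnP n p) => [/centralr_unit//|lepn].
rewrite (divn_eq n p) mulnC centralr_prime_mulD ?ltn_mod //.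
apply: unit_mod_prime; rewrite unitrM centralr_unit ?ltn_mod // IH //.
by rewrite ltn_Pdiv // 1?(leq_trans _ lepn) // (ltn_trans _ p_gt2).
Qed.

(** [A] holds the multipliers met while stripping trailing digits [p - 1], each of which multiplies
    [a] by [s]. At any other last digit, [K_a] is a unit or is settled by two digits up to a unit
    value of [T]. *)
Lemma motzkin_form_neq0 (A : R -> Prop) a m : A a ->
  (forall a, A a -> A (a * s)) ->
  (forall a d, A a -> (d.+1 < p)%N -> K a d \is a GRing.unit \/
     (exists f, K a d = p%:R * f) /\ forall e, (e < p)%N -> K a (p * e + d) != 0) ->
  K a m != 0.
Proof.
move=> Aa A_s A_digit; elim/ltn_ind: m a Aa => m IH a Aa.
have ltmod : (m %% p < p)%N by rewrite ltn_mod.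
have := divn_eq m p; rewrite mulnC => defm.
have [lt_d|] := ltnP (m %% p).+1 p; last first.
  move=> led; have ed : (m %% p = p.-1)%N by lia.
  have lt_m : (m %/ p < m)%N.
    by rewrite ltn_Pdiv ?(ltn_trans _ p_gt2) //; case: (m) ed => //; rewrite mod0n; lia.
  by rewrite defm ed motzkin_form_pred; apply: IH => //; apply: A_s.
case: (A_digit _ _ Aa lt_d) => [unitK|[[f Kf] K_neq0]]; rewrite defm.
  apply/negP => /eqP K0; have : K a (p * (m %/ p) + m %% p) \is a GRing.unit.
    by rewrite motzkin_form_digit // unit_mod_prime // unitrM unitK centralr_all_unit.
  by rewrite K0 unitr0.
rewrite (divn_eq (m %/ p) p) [(_ * p)%N]mulnC (motzkin_form_digits _ _ _ Kf) ?ltn_mod //.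
apply/negP => /eqP/(congr1 (fun x => x / t (m %/ p %/ p))).
by rewrite mulrK ?centralr_all_unit // mul0r => /eqP; apply/negP/K_neq0; rewrite ltn_mod.
Qed.

Lemma motzkinr_neq0 n :
  (forall d, (d.+2 < p)%N -> 3 * t d + t d.+1 \is a GRing.unit) ->
  (forall m, K 3 m != 0) -> (forall m, K (-1) m != 0) -> motzkinr n != 0.
Proof.
move=> unit_digit K3 K1; have ltmod : (n %% p < p)%N by rewrite ltn_mod.
have := divn_eq n p; rewrite mulnC => defn; apply/eqP => M0.
have [lt_d|] := ltnP (n %% p).+2 p; last first.
  move=> led; have [ed|ed] : (n %% p = p.-1)%N \/ (n %% p = p.-2)%N by lia.
    by have := motzkinr_pred (n %/ p); rewrite -ed -defn M0 !mulr0 => /esym/eqP; apply/negP.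
  have := motzkinr_pred2 (n %/ p); rewrite -ed -defn M0 mulr0 => /esym e0.
  have u : - (1 + (p * (n %/ p).+1)%:R : R) \is a GRing.unit.
    by rewrite unitrN natrM unit_mod_prime ?unitr1.
  by have /eqP[] := K1 (n %/ p)%N; apply: (mulrI u); rewrite e0 mulr0.
have /esym := motzkinr_central n; rewrite M0 !mulr0 defn.
rewrite -addnS !centralr_prime_mulD // 1?ltnW //.
set x := t (n %/ p)%N; set z := (n %/ p)%:R * x; set y := (n %/ p)%:R * t (n %/ p).-1.
have -> : 3 * (t (n %% p) * x + p%:R * (b (n %% p) * z + c (n %% p) * y))
    + (t (n %% p).+1 * x + p%:R * (b (n %% p).+1 * z + c (n %% p).+1 * y))
  = (3 * t (n %% p) + t (n %% p).+1) * x
    + p%:R * (3 * (b (n %% p) * z + c (n %% p) * y)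
              + (b (n %% p).+1 * z + c (n %% p).+1 * y)) by ring.
move=> e0; have := unitr0 R; rewrite -e0 unit_mod_prime // unitrM centralr_all_unit.
by rewrite unit_digit.
Qed.

End NonVanishing.

End DigitExpansion.
End ModuloPrimeSquare.

(** * Executable tables and tests over [Z] *)

Section Computation.

Local Open Scope Z_scope.

(** A sliding window over [T(n)] and [T(n + 1)]; on these values the division is exact by
    [centralSS]. *)
Fixpoint central_table (k : nat) (n x y : Z) : seq Z :=
  if k is k'.+1 then
    x :: central_table k' (n + 1) y (((2 * n + 3) * y + 3 * (n + 1) * x) / (n + 2))
  else [::].

(* [invs] holds the inverses of d + 1, ..., 1 modulo the prime p, then 0, and
   (d + 2)^-1 = - (p / (d + 2)) * (p mod (d + 2))^-1. *)
Fixpoint digit_table (p : Z) (k : nat) (d : Z) (invs ts : seq Z) (b0 c0 b1 c1 : Z) :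
    seq (Z * Z) :=
  if k is k'.+1 then
    let i := ((p - p / (d + 2)) * nth 0 invs (Z.to_nat (d + 1 - p mod (d + 2)))) mod p in
    let t0 := nth 0 ts 0 in let t1 := nth 0 ts 1 in let t2 := nth 0 ts 2 in
    let b2 := (i * ((2 * d + 3) * b1 + 3 * (d + 1) * b0 + 2 * t1 + 3 * t0 - t2)) mod p in
    let c2 := (i * ((2 * d + 3) * c1 + 3 * (d + 1) * c0)) mod p in
    (b0, c0) :: digit_table p k' (d + 1) (i :: invs) (behead ts) b1 c1 b2 c2
  else [::].

Section Check.
Variables (p : nat) (ts : seq Z) (s : Z) (bc : seq (Z * Z)).
Let P := Z.of_nat p.
Let P2 := P * P.
Let T i := nth 0 ts i.
Let B i := (nth (0, 0) bc i).1.
Let C i := (nth (0, 0) bc i).2.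
Let w := T p.-1 - s.

(** Tests the numerical conditions of [digit_coefs], so that the output of [digit_table] and the
    choice of sign are certified after the fact. *)
Definition tables_ok : bool :=
  [&& T p =? 1, w mod P =? 0, (P * B p.-1 - w) mod P2 =? 0, C p.-1 =? 0,
      B 0 =? 0, B 1 =? 1, C 0 =? 0, C 1 =? 3 * s &
      all (fun d => let D := Z.of_nat d in
        (((D + 2) * B d.+2 - ((2 * D + 3) * B d.+1 + 3 * (D + 1) * B d
            + 2 * T d.+1 + 3 * T d - T d.+2)) mod P =? 0) &&
        (((D + 2) * C d.+2 - ((2 * D + 3) * C d.+1 + 3 * (D + 1) * C d)) mod P =? 0))
      (iota 0 p.-2)].

(** [form1 a d] stands for [K_a(d)], and [form2 a d e] for [K_a(p e + d)] as expanded in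
    [motzkin_form_digit]. *)
Definition form1 (a : Z) d := a * (s + (Z.of_nat d + 1) * w) * T d + T d.+1.

Definition form2 (a : Z) d e :=
  form1 a d * T e
    + P * ((a * s * B d + B d.+1) * (Z.of_nat e * T e)
           + (a * s * C d + C d.+1) * (Z.of_nat e * T e.-1)).

(** The four multipliers are the closure of 3 and -1 under multiplication by the sign [s]. *)
Definition good : bool :=
  [&& tables_ok, all (fun d => ~~ (T d mod P =? 0)) (iota 0 p),
      all (fun d => ~~ ((3 * T d + T d.+1) mod P =? 0)) (iota 0 p.-2) &
      all (fun a => all (fun d => if form1 a d mod P =? 0
          then all (fun e => ~~ (form2 a d e mod P2 =? 0)) (iota 0 p) else true)
        (iota 0 p.-1))
      [:: 3; -1; 3 * s; - s]].

Definition witness d e : bool :=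
  [&& tables_ok, (d.+1 < p)%N, (e < p)%N &
      has (fun a => form2 a d e mod P2 =? 0) [:: 3; 3 * s]].

End Check.

(** The table is cut after [T(p)], which [tables_ok] reads. The sign is a guess for [T(p - 1)]
    modulo [p]; [tables_ok] rejects a wrong one. *)
Definition with_digit_tables (A : Type) (f : nat -> seq Z -> Z -> seq (Z * Z) -> A)
    (tab : seq Z) (p : nat) : A :=
  let P := Z.of_nat p in
  let P2 := P * P in
  let ts := [seq x mod P2 | x <- take p.+1 tab] in
  let s := if nth 0 ts p.-1 mod P =? 1 then 1 else -1 in
  f p ts s (digit_table P p 0 [:: 1; 0] ts 0 0 1 (3 * s)).

Definition central_table200 := central_table 200 0 1 1.

End Computation.

Delimit Scope Z_scope with BZ.

Local Arguments Z.mul : simpl never.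
Local Arguments Z.add : simpl never.

Lemma nth_central_table k n i : (i < k)%N ->
  nth Z0 (central_table k (Z.of_nat n) (Z_of_int (central n)) (Z_of_int (central n.+1))) i
    = Z_of_int (central (n + i)).
Proof.
elim: k n i => // k IH n [|i] lti; first by rewrite addn0.
rewrite [LHS]/= -addSnnS -IH //; congr (nth _ (central_table _ _ _ _) _); first by lia.
have := centralSS n; move: (central n.+2) (central n.+1) (central n) => z y x rec.
by symmetry; apply: Z.div_unique_exact; lia.
Qed.

Lemma nth_central_table200 i : (i < 200)%N -> nth Z0 central_table200 i = Z_of_int (central i).
Proof.
have e0 : central 0 = 1 by rewrite /central expr0 coef1.
have e1 : central 1 = 1 by rewrite /central expr1 coef_trinomial.
by have := @nth_central_table 200 0 i; rewrite e0 e1.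
Qed.

(** * From the tests over [Z] to divisibility by [p^2] *)

Section Bridge.

Variables (p : nat) (p_prime : prime p).

Let p_gt0 : (0 < p)%N := prime_gt0 p_prime.
Let p2_gt1 : (1 < p ^ 2)%N.
Proof. by rewrite -[1%N]/(1 ^ 2)%N ltn_sqr prime_gt1. Qed.

Local Notation R := 'Z_(p ^ 2).

Lemma p2_eq0 : p%:R ^+ 2 = 0 :> R.
Proof. by rewrite -natrX; apply: val_inj; rewrite /= val_Zp_nat // modnn. Qed.

Definition zr (z : Z) : R := (int_of_Z z)%:~R.

Let zrD x y : zr (Z.add x y) = zr x + zr y. Proof. by rewrite /zr -rmorphD -rmorphD. Qed.
Let zrN x : zr (Z.opp x) = - zr x. Proof. by rewrite /zr -rmorphN -rmorphN. Qed.
Let zrB x y : zr (Z.sub x y) = zr x - zr y. Proof. by rewrite -zrN -zrD. Qed.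
Let zrM x y : zr (Z.mul x y) = zr x * zr y. Proof. by rewrite /zr -rmorphM -rmorphM. Qed.
Let zr_nat n : zr (Z.of_nat n) = n%:R.
Proof. by rewrite /zr (_ : int_of_Z _ = n) ?pmulrn //; lia. Qed.
Let zr1 : zr 1%BZ = 1. Proof. exact: (zr_nat 1). Qed.
Let zrN1 : zr (-1)%BZ = -1. Proof. by rewrite -zr1 -zrN. Qed.

Let P := Z.of_nat p.

Lemma zr_mod_eq0 x : (x mod (P * P) =? 0)%BZ -> zr x = 0.
Proof.
move/Z.eqb_eq => x0; rewrite (Z.div_mod x (P * P)%BZ) ?x0; last by rewrite /P; lia.
by rewrite zrD !zrM zr_nat -expr2 p2_eq0 mul0r add0r.
Qed.

Lemma zr_mod_prime_eq0 x : (x mod P =? 0)%BZ -> exists y, zr x = p%:R * y.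
Proof.
move/Z.eqb_eq => x0; exists (zr (Z.div x P)).
rewrite {1}(Z.div_mod x P) ?x0; last by rewrite /P; lia.
by rewrite zrD !zrM zr_nat addr0.
Qed.

Lemma dvd_intr_eq0 (x : int) : (p%:Z ^+ 2 %| x)%Z -> x%:~R = 0 :> R.
Proof.
by case/dvdzP=> y ->; rewrite rmorphM rmorphXn /= -pmulrn p2_eq0 mulr0.
Qed.

Lemma intr_eq0_dvd (x : int) : (x%:~R : R) = 0 -> (p%:Z ^+ 2 %| x)%Z.
Proof.
have dvd n : (n%:R : R) = 0 -> (p ^ 2 %| n)%N.
  by move/(congr1 (@nat_of_ord _)); rewrite val_Zp_nat // /dvdn => ->.
rewrite dvdzE abszX absz_nat; case: x => n; first by rewrite -pmulrn => /dvd.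
by rewrite NegzE rmorphN /= -pmulrn => /eqP; rewrite oppr_eq0 => /eqP/dvd.
Qed.

Lemma zr_eq0 x : zr x = 0 -> (x mod (P * P) =? 0)%BZ.
Proof.
move=> /intr_eq0_dvd/dvdzP[y xE]; apply/Z.eqb_eq.
apply/Z.mod_divide; first by rewrite /P; lia.
exists (Z_of_int y); rewrite /P; move: xE; rewrite expr2; lia.
Qed.

Lemma zr_unit x : ~~ (x mod P =? 0)%BZ -> zr x \is a GRing.unit.
Proof.
move=> ndvd; apply: (unit_ndvd_prime p_prime p2_eq0); apply: contra ndvd.
move/dvdzP => [y xE]; apply/Z.eqb_eq/Z.mod_divide; first by rewrite /P; lia.
exists (Z_of_int y); rewrite /P; move: xE; lia.
Qed.

Lemma zr_central i : (i < 200)%N -> zr (nth Z0 central_table200 i) = centralr R i.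
Proof. by move=> lti; rewrite nth_central_table200 // /zr Z_of_intK. Qed.

(** [bc] stays arbitrary here: whatever is needed of it comes from [tables_ok]. *)
Lemma with_digit_tablesP (A : Type) (f : nat -> seq Z -> Z -> seq (Z * Z) -> A)
    (Q : A -> Prop) :
  (p < 200)%N ->
  (forall ts s bc, (forall i, (i <= p)%N -> zr (nth Z0 ts i) = centralr R i) ->
     s = 1%BZ \/ s = (-1)%BZ -> Q (f p ts s bc)) ->
  Q (with_digit_tables f central_table200 p).
Proof.
move=> ltp; apply=> [i lei|]; last by case: Z.eqb; [left|right].
rewrite (nth_map Z0) ?nth_take ?size_takel //.
have lti : (i < 200)%N := leq_ltn_trans lei ltp.
rewrite -zr_central //; move: (nth _ _ _) => x.
rewrite [in RHS](Z.div_mod x (P * P)); last by rewrite /P; lia.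
by rewrite zrD !zrM zr_nat -expr2 p2_eq0 mul0r add0r.
Qed.

Hypothesis p_gt2 : (2 < p)%N.

Let unit2 : (2%:R : R) \is a GRing.unit.
Proof. by have := @unit_mod_prime_nat R p p_prime p2_eq0 0 2; rewrite muln0; apply. Qed.

Section Tables.

Variables (ts : seq Z) (s : Z) (bc : seq (Z * Z)).
Hypothesis ts_central : forall i, (i <= p)%N -> zr (nth Z0 ts i) = centralr R i.
Hypothesis s_sign : s = 1%BZ \/ s = (-1)%BZ.
Hypothesis ok : tables_ok p ts s bc.

Let b i := zr (nth (Z0, Z0) bc i).1.
Let c i := zr (nth (Z0, Z0) bc i).2.
Let zrE := (zrD, zrB, zrN, zrM, zr_nat, zr1).

Lemma tables_digit_coefs : digit_coefs p (zr s) b c.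
Proof.
have p_mod x y : ((x - y) mod P =? 0)%BZ -> p%:R * zr x = p%:R * zr y.
  move=> /zr_mod_prime_eq0[z]; rewrite zrB => /(canRL (subrK _)) ->.
  by rewrite mulrDr mulrA -expr2 p2_eq0 mul0r add0r.
have z2 : zr 2%BZ = 2 by exact: (zr_nat 2).
have z3 : zr 3%BZ = 3 by exact: (zr_nat 3).
have pgt1 : (p.-1 < p)%N by rewrite prednK.
case/and5P: ok => /Z.eqb_eq Tp Tp1 b_p /Z.eqb_eq c_p /and5P[/Z.eqb_eq b0 /Z.eqb_eq b1
  /Z.eqb_eq c0 /Z.eqb_eq c1 /allP rec].
split.
- by rewrite -ts_central // Tp zr1.
- by case: s_sign => ->; rewrite ?zrN1 ?zr1 ?sqrrN expr1n.
- by rewrite -ts_central ?leq_pred //; apply: p_mod.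
- by rewrite /b b0.
- by rewrite /b b1 zr1.
- by rewrite /c c0.
- by rewrite /c c1 zrM z3.
- move=> d ltd; have /rec/andP[/p_mod + _] : d \in iota 0 p.-2.
    by rewrite mem_iota; lia.
  have tc i : (i < d.+3)%N -> zr (nth Z0 ts i) = centralr R i.
    by move=> lti; apply: ts_central; lia.
  rewrite !zrE z2 z3 !tc ?ltnS ?leqnSn ?leqW // -/(b d) -/(b d.+1) -/(b d.+2).
  rewrite (_ : d.+2%:R = d%:R + 2) => [->|]; last by ring.
  by congr (_ * _); ring.
- move=> d ltd; have /rec/andP[_ /p_mod] : d \in iota 0 p.-2.
    by rewrite mem_iota; lia.
  rewrite !zrE z2 z3 -/(c d) -/(c d.+1) -/(c d.+2).
  rewrite (_ : d.+2%:R = d%:R + 2) => [->|]; last by ring.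
  by congr (_ * _); ring.
- have /zr_mod_eq0/eqP := b_p; rewrite zrB subr_eq0 !zrE ts_central ?leq_pred //.
  by move/eqP.
- by rewrite /c c_p mulr0.
Qed.

Let coefs := tables_digit_coefs.

Lemma zr_form1 a d : (d.+1 < p)%N ->
  zr (form1 p ts s a d) = motzkin_form p (zr s) (zr a) d.
Proof.
move=> ltd; rewrite /form1 /motzkin_form !zrE !ts_central; try lia.
by rewrite natr1.
Qed.

Lemma zr_form2 a d e : (d.+1 < p)%N -> (e < p)%N ->
  zr (form2 p ts s bc a d e) = motzkin_form p (zr s) (zr a) (p * e + d).
Proof.
move=> ltd lte; rewrite (motzkin_form_digit p_prime p2_eq0 coefs) //.
rewrite /form2; have := zr_form1 a ltd; move: (form1 p ts s a d) => f fE.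
by rewrite !zrE fE !ts_central //; lia.
Qed.

Lemma good_motzkin_neq0 n : good p ts s bc -> motzkinr R n != 0.
Proof.
case/and4P=> _ /allP T_unit /allP M_unit /allP forms.
have unitT d : (d < p)%N -> centralr R d \is a GRing.unit.
  move=> ltd; rewrite -ts_central ?(ltnW ltd) //; apply: zr_unit; apply: T_unit.
  by rewrite mem_iota.
have z3 : zr 3%BZ = 3 by exact: (zr_nat 3).
pose A (a : R) := exists2 z, z \in [:: 3; -1; 3 * s; - s]%BZ & a = zr z.
have A_s a : A a -> A (a * zr s).
  case=> z z_in ->; exists (z * s)%BZ; last by rewrite zrM.
  by case: s_sign z_in => ->; rewrite !inE => /or4P[] /eqP ->.
have K_neq0 a m : A a -> motzkin_form p (zr s) a m != 0.
  move=> Aa; apply: (motzkin_form_neq0 p_prime p2_eq0 coefs p_gt2 unitT _ Aa A_s).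
  move=> _ d [z /forms/allP z_in ->] ltd.
  have /z_in : d \in iota 0 p.-1 by rewrite mem_iota; lia.
  case: ifP => [/zr_mod_prime_eq0 Kd /allP Ke|/negbT/zr_unit]; last first.
    by rewrite zr_form1 //; left.
  right; rewrite -zr_form1 //; split=> // e lte; rewrite -zr_form2 //.
  have /Ke : e \in iota 0 p by rewrite mem_iota.
  by apply: contra => /eqP/zr_eq0.
apply: (motzkinr_neq0 p_prime p2_eq0 coefs p_gt2 unitT).
- move=> d ltd; rewrite -!ts_central -?z3; try lia.
  rewrite -zrM -zrD; apply/zr_unit/M_unit.
  by rewrite mem_iota; lia.
- by move=> m; apply: K_neq0; exists 3%BZ; rewrite ?inE.
- by move=> m; apply: K_neq0; exists (-1)%BZ; rewrite ?inE // zrN1.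
Qed.

Lemma motzkin_form3_eq0 m : motzkin_form p (zr s) 3 m = 0 ->
  motzkinr R (p * m + p.-1) = 0.
Proof.
move=> K0; have := motzkinr_pred p_prime p2_eq0 coefs m; rewrite K0.
have u : ((p * m + p.+1)%:R : R) \is a GRing.unit.
  have := @unit_mod_prime_nat R p p_prime p2_eq0 m.+1 1.
  by rewrite (_ : (p * m.+1 + 1 = p * m + p.+1)%N) => [->|] //; lia.
by move=> M0; apply: (mulrI u); apply: (mulrI unit2); rewrite M0 !mulr0.
Qed.

(** A zero [m] of [K_3] gives [n = p m + p - 1]. A zero of [K_(3 s)] becomes a zero of [K_3] after
    appending a digit [p - 1]. *)
Lemma witness_dvd_motzkin d e : witness p ts s bc d e ->
  exists n, (p%:Z ^+ 2 %| motzkin n)%Z.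
Proof.
case/and4P=> _ ltd lte /hasP[a a_in /zr_mod_eq0]; rewrite zr_form2 // => K0.
have z3 : zr 3%BZ = 3 by exact: (zr_nat 3).
suff [m K3] : exists m, motzkin_form p (zr s) 3 m = 0.
  by exists (p * m + p.-1)%N; apply/intr_eq0_dvd/motzkin_form3_eq0.
move: a_in K0; rewrite !inE => /orP[] /eqP ->; rewrite ?zrM z3 => K0.
  by exists (p * e + d)%N.
by exists (p * (p * e + d) + p.-1)%N; rewrite (motzkin_form_pred p_prime p2_eq0 coefs).
Qed.

End Tables.

(** As [2 (n + 2)] is a unit, two table entries decide. This serves [p = 19] with [n = 65]. *)
Lemma table_dvd_motzkin n : (n.+1 < 200)%N -> ~~ (p %| n.+2)%N ->
  ((3 * nth Z0 central_table200 n + nth Z0 central_table200 n.+1) mod (P * P) =? 0)%BZ ->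
  (p%:Z ^+ 2 %| motzkin n)%Z.
Proof.
move=> ltn ndvd /zr_mod_eq0; rewrite zrD zrM !zr_central // 1?ltnW //.
rewrite (zr_nat 3) -(motzkinr_central R n) => M0; apply: intr_eq0_dvd.
have u : (n.+2%:R : R) \is a GRing.unit.
  by rewrite pmulrn (unit_ndvd_prime p_prime p2_eq0) // dvdzE.
by apply: (mulrI u); apply: (mulrI unit2); rewrite !mulr0.
Qed.

End Bridge.

(** * The finite computations and the conclusion *)

Definition nonvanishing_primes := [:: 5; 13; 31; 37; 61; 79; 97; 103]%N.

Lemma good_nonvanishing_primes :
  all (with_digit_tables good central_table200) nonvanishing_primes.
Proof. by vm_compute. Qed.

(* [(p, (d, e))]: K_3 or K_(3 s) vanishes modulo p^2 at p e + d. *)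
Definition witnesses : seq (nat * (nat * nat)) :=
  [:: (7, (2, 3)); (11, (1, 0)); (17, (10, 5)); (23, (1, 21)); (29, (9, 26));
      (41, (2, 32)); (43, (2, 9)); (47, (1, 25)); (53, (1, 17));
      (59, (1, 57)); (67, (65, 9)); (71, (1, 41)); (73, (8, 9));
      (83, (81, 8)); (89, (46, 29)); (101, (1, 40)); (107, (38, 26));
      (109, (53, 61)); (113, (1, 28)); (127, (7, 71)); (131, (9, 123));
      (137, (1, 107)); (139, (137, 4)); (149, (1, 59)); (151, (149, 34));
      (157, (155, 20)); (163, (50, 153)); (167, (1, 64)); (173, (1, 35));
      (179, (1, 13)); (181, (57, 116)); (191, (87, 95)); (193, (191, 49));
      (197, (1, 45)); (199, (37, 61))]%N.

Lemma witnesses_ok :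
  all (fun x => with_digit_tables
    (fun p ts s bc => witness p ts s bc x.2.1 x.2.2) central_table200 x.1) witnesses.
Proof. by vm_compute. Qed.

Lemma primes_covered :
  all (fun p => p \in [:: 2; 3; 19]%N ++ nonvanishing_primes ++ map fst witnesses)
    [seq p <- iota 0 200 | prime p].
Proof. by vm_compute. Qed.

Local Close Scope ring_scope.

Theorem theorem3p3 :
  (forall p : nat, p \in [:: 5; 13; 31; 37; 61; 79; 97; 103] ->
     forall n : nat, (motzkin n != 0 %[mod p%:Z ^+ 2])%Z)
  /\
  (forall p : nat, prime p -> p < 200 ->
     p \notin [:: 5; 13; 31; 37; 61; 79; 97; 103] ->
     exists n : nat, (p%:Z ^+ 2 %| motzkin n)%Z).
Proof.
split=> [p p_list n | p p_prime ltp p_nlist].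
  have p_prime : prime p by apply: (allP (_ : all prime nonvanishing_primes)).
  have [p_gt2 ltp] : (2 < p)%N /\ (p < 200)%N.
    by apply/andP; apply: (allP (_ : all (fun p : nat => (2 < p < 200)%N) nonvanishing_primes)).
  rewrite eqz_mod_dvd subr0; apply/negP => /(dvd_intr_eq0 p_prime)/eqP; apply/negP.
  have := allP good_nonvanishing_primes p p_list.
  apply: (@with_digit_tablesP p p_prime _ good (fun b => b -> motzkinr _ n != 0)%R ltp).
  move=> ts s bc ts_ok s_ok ok.
  have tabs_ok : tables_ok p ts s bc by case/and4P: ok.
  exact: (good_motzkin_neq0 p_prime p_gt2 ts_ok s_ok tabs_ok).
have : p \in [:: 2; 3; 19]%N ++ nonvanishing_primes ++ map fst witnesses.
  by apply: (allP primes_covered); rewrite mem_filter p_prime mem_iota.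
rewrite !mem_cat (negPf p_nlist) => /or3P[|//|/mapP [[q [d e]] q_in /= pq]].
  rewrite !inE => /or3P[] /eqP ->.
  (* [M(3) = 4] and [M(4) = 9] settle the primes 2 and 3. *)
  - by exists 3; rewrite motzkin_sum !big_ord_recr big_ord0.
  - by exists 4; rewrite motzkin_sum !big_ord_recr big_ord0.
  - by exists 65; apply: table_dvd_motzkin.
rewrite -{}pq in q_in.
have p_gt2 : (2 < p)%N.
  by have /= := allP (_ : all (fun x : nat * (nat * nat) => (2 < x.1)%N) witnesses) _ q_in; apply.
have := allP witnesses_ok _ q_in => /=.
apply: (@with_digit_tablesP p p_prime _ (fun p ts s bc => witness p ts s bc d e)
  (fun b => b -> exists n, p%:Z ^+ 2 %| motzkin n)%Z ltp).
move=> ts s bc ts_ok s_ok wit.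
have tabs_ok : tables_ok p ts s bc by case/and4P: wit.
exact: (witness_dvd_motzkin p_prime p_gt2 ts_ok s_ok tabs_ok wit).
Qed.
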